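(* A quantale $Q$ is Noetherian if and only if, for every class $\Sigma_Q$ of proper ideals of $Q$, the quantale space $\Sigma_Q$ is quasi-compact.
   Context: A quantale here means a complete lattice $(Q,\preccurlyeq,\bot,\top)$ with a binary operation $\&$ that is associative, commutative, satisfies $x\&\bigl(\bigvee_{\lambda} y_\lambda\bigr)=\bigvee_\lambda (x\& y_\lambda)$ for all families, and satisfies $x\&\top=x$ for all $x$. An ideal of $Q$ is a nonempty subset $I\subseteq Q$ such that $x,y\in I$ implies $x\vee y\in I$, and $x\in I$, $l\preccurlyeq x$ imply $l\in I$. $\mathcal I_Q$ is the set of all ideals of $Q$. An ideal is proper if $I\neq Q$. $Q$ is Noetherian if every ascending chain of ideals of $Q$ is eventually stationary. For a set $\Sigma_Q$ of proper ideals of $Q$ and $X\subseteq \mathcal I_Q$, put $X^{\uparrow}=\{J\in\Sigma_Q\mid \bigcap X\subseteq J\}$ if $X\neq\emptyset$ and $\emptyset^{\uparrow}=\emptyset$. The quantale topology on $\Sigma_Q$ is the topology having the sets $X^{\uparrow}$ ($X\subseteq \mathcal I_Q$) as a subbasis of closed sets; $\Sigma_Q$ with this topology is called a quantale space. A space is quasi-compact if every open cover has a finite subcover (no Hausdorff assumption). *)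

(* Defs.v *)
From HB Require Import structures.
From mathcomp Require Import all_boot all_order.
From mathcomp Require Import boolp classical_sets topology.

Set Implicit Arguments.
Unset Strict Implicit.
Unset Printing Implicit Defensive.

Local Open Scope classical_set_scope.

HB.mixin Record TBLattice_isComplete (d : Order.disp_t) T
    & Order.TBLattice d T := {
  bigjoin : set T -> T;
  bigmeet : set T -> T;
  bigjoinP : forall A : set T, supremums A (bigjoin A);
  bigmeetP : forall A : set T, infimums A (bigmeet A)
}.

#[short(type="completeLatticeType")]
HB.structure Definition CompleteLattice (d : Order.disp_t) :=
  { T of TBLattice_isComplete d T & Order.TBLattice d T }.

(* Subsets of T stand for families of elements of T in the distributivity
   axiom; the empty subset is included. *)
HB.mixin Record CompleteLattice_isQuantale (d : Order.disp_t) T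
    & CompleteLattice d T := {
  qmul : T -> T -> T;
  qmulA : associative qmul;
  qmulC : commutative qmul;
  qmul_bigjoinr : forall (x : T) (A : set T),
    qmul x (bigjoin A) = bigjoin [set qmul x y | y in A];
  qmulx1 : right_id (Order.top : T) qmul
}.

#[short(type="quantaleType")]
HB.structure Definition Quantale (d : Order.disp_t) :=
  { T of CompleteLattice_isQuantale d T & CompleteLattice d T }.

Section Ideals.
Context {d : Order.disp_t} {Q : quantaleType d}.
Implicit Types I : set Q.

Definition is_ideal I : Prop :=
  [/\ I !=set0,
      (forall x y : Q, I x -> I y -> I (x `|` y)%O) &
      (forall x l : Q, I x -> (l <= x)%O -> I l)].

Definition proper_ideal I : Prop := is_ideal I /\ I <> setT.

End Ideals.

Definition noetherian_quantale (d : Order.disp_t) (Q : quantaleType d) : Prop :=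
  forall I : nat -> set Q,
    (forall n, is_ideal (I n)) -> (forall n, I n `<=` I n.+1) ->
    exists N, forall n, (N <= n)%N -> I n = I N.

(* An alias of set_type Sigma, so that the topology below is not attached to
   every subtype of set Q. *)
Definition quantale_space (d : Order.disp_t) (Q : quantaleType d)
  (Sigma : set (set Q)) : Type := set_type Sigma.

Section QuantaleTopology.
Context {d : Order.disp_t} {Q : quantaleType d} (Sigma : set (set Q)).

(* The intersection over an empty X is setT, contained in no proper ideal;
   the conjunct X !=set0 makes the upper set of set0 empty for any Sigma. *)
Definition up_set (X : set (set Q)) : set (quantale_space Sigma) :=
  [set J | X !=set0 /\ \bigcap_(I in X) I `<=` val (J : set_type Sigma)].

HB.instance Definition _ := Choice.copy (quantale_space Sigma) (set_type Sigma).

(* The complements of a subbasis of closed sets form a subbasis of open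
   sets. *)
HB.instance Definition _ :=
  @isSubBaseTopological.Build (quantale_space Sigma)
    (set (set Q)) [set X | X `<=` is_ideal] (fun X => ~` up_set X).

End QuantaleTopology.

(* Main.v *)
Require Import Defs.
From mathcomp Require Import all_boot all_order.
From mathcomp Require Import finmap boolp classical_sets topology.

Import Order.LTheory.

Local Open Scope classical_set_scope.

(* The subbasic closed sets are [h(I) = {J | I `<=` J}] for an ideal [I], and
   [h(I) `&` h(I') = h(I \/ I')].  For an ultrafilter [F] on [Sigma], the
   ideals [I] with [h(I)] in [F] are therefore directed, so when [Q] is
   Noetherian they have a largest element [K]; any [J] in the nonempty set
   [h(K)] is a limit of [F].  Conversely, the members of an ascending chain
   that is not stationary are proper ideals, and the complements of the
   [h(I n)] cover [Sigma = {I n | n}] without a finite subcover. *)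

(** If no finite subfamily covers, the complements have the finite intersection property and
    generate a proper filter; a cluster point of it lies in some [f i], which then meets its own
    complement. *)
Lemma compact_setT_cover_compact (T : topologicalType) :
  compact [set: T] -> cover_compact [set: T].
Proof.
move=> cT I D f fop fcov; apply: contrapT => nfin.
have finIf : finI D (fun i => ~` f i).
  move=> D' sD'; apply: contrapT => nx; apply: nfin; exists D'; first exact: sD'.
  move=> x _; apply: contrapT => nfx; apply: nx; exists x => i D'i fix_.
  by apply: nfx; exists i.
have FF := finI_filter finIf.
have [p [_ clp]] := cT _ FF filterT.
have [i Di fip] := fcov p Logic.I.
have [x [nfix fix_]] : (~` f i) `&` f i !=set0.
  apply: clp; last by apply: open_nbhs_nbhs; split => //; exact: fop.
  by exists (~` f i) => //; exact: (finI_from1 (fun j => ~` f j)).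
exact: nfix.
Qed.

Section Ideals.
Context {d : Order.disp_t} {Q : quantaleType d}.
Implicit Types I J : set Q.

Lemma ideal_bot I : is_ideal I -> I \bot%O.
Proof. by case=> -[x Ix] _ lI; apply: (lI x) => //; exact: le0x. Qed.

Lemma bigcap_ideal (X : set (set Q)) :
  X `<=` is_ideal -> is_ideal (\bigcap_(I in X) I).
Proof.
move=> Xid; split.
- by exists \bot%O => I /Xid; exact: ideal_bot.
- by move=> x y Ix Iy I XI; have [_ + _] := Xid _ XI; apply; [exact: Ix|exact: Iy].
- by move=> x l Ix lx I XI; have [_ _ +] := Xid _ XI; apply; [exact: Ix|].
Qed.

(** The join in the lattice of ideals. It is closed downwards by construction, since in a
    non-distributive lattice the pairwise joins alone need not form a lower set. *)
Definition ideal_join I J : set Q :=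
  [set z | exists x y, [/\ I x, J y & (z <= x `|` y)%O]].

Lemma ideal_join_ideal I J : is_ideal I -> is_ideal J -> is_ideal (ideal_join I J).
Proof.
move=> idI idJ; have [_ uI _] := idI; have [_ uJ _] := idJ; split.
- by exists \bot%O; exists \bot%O, \bot%O; split;
    [exact: ideal_bot|exact: ideal_bot|exact: le0x].
- move=> z t [x [y [Ix Jy zxy]]] [u [v [Iu Jv tuv]]].
  exists (x `|` u)%O, (y `|` v)%O; split; [exact: uI|exact: uJ|].
  by rewrite joinACA; exact: leU2.
- move=> z l [x [y [Ix Jy zxy]]] lz; exists x, y; split => //.
  exact: le_trans zxy.
Qed.

Lemma ideal_joinl I J : is_ideal J -> I `<=` ideal_join I J.
Proof.
by move=> /ideal_bot J0 x Ix; exists x, \bot%O; split => //; exact: leUl.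
Qed.

Lemma ideal_joinr I J : is_ideal I -> J `<=` ideal_join I J.
Proof.
by move=> /ideal_bot I0 y Jy; exists \bot%O, y; split => //; exact: leUr.
Qed.

Lemma ideal_join_sub {I J} K :
  is_ideal K -> I `<=` K -> J `<=` K -> ideal_join I J `<=` K.
Proof.
move=> [_ uK lK] IK JK z [x [y [Ix Jy zxy]]].
by apply: lK zxy; apply: uK; [exact: IK|exact: JK].
Qed.

(** Without a maximal member, dependent choice along strict inclusions yields a chain in [A] that
    never becomes stationary. *)
Lemma noetherian_maximal {A : set (set Q)} :
  noetherian_quantale Q -> A `<=` is_ideal -> A !=set0 ->
  exists2 K, A K & forall I, A I -> K `<=` I -> I `<=` K.
Proof.
move=> noeth Aid [I0 AI0]; apply: contrapT => nmax.
have next (I : set_type A) :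
    {I' : set_type A | val I `<=` val I' /\ ~ (val I' `<=` val I)}.
  apply: cid; case: I => I /[dup] /set_mem AI memAI; apply: contrapT => nI.
  apply: nmax; exists I => // I' AI' II'; apply: contrapT => nI'I.
  by apply: nI; exists (SigSub (mem_set AI')).
have [f [_ fS]] := dependent_choice next (SigSub (mem_set AI0)).
have [|n|N fN] := noeth (fun n => val (f n)).
- by move=> n; apply: Aid; exact: set_mem (valP (f n)).
- by have [] := fS n.
- by have [_ []] := fS N; rewrite fN.
Qed.

Lemma noetherian_largest {A : set (set Q)} :
  noetherian_quantale Q -> A `<=` is_ideal -> A !=set0 ->
  (forall I J, A I -> A J -> A (ideal_join I J)) ->
  exists2 K, A K & forall I, A I -> I `<=` K.
Proof.
move=> noeth Aid A0 Ajoin.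
have [K AK Kmax] := noetherian_maximal noeth Aid A0.
exists K => // I AI; apply: subset_trans (Kmax _ (Ajoin _ _ AK AI) _).
- by apply: ideal_joinr; exact: Aid.
- by apply: ideal_joinl; exact: Aid.
Qed.

End Ideals.

Section QuantaleSpace.
Context {d : Order.disp_t} {Q : quantaleType d} (Sigma : set (set Q)).

Local Notation point J := (val (J : set_type Sigma)).

Definition above (I : set Q) : set (quantale_space Sigma) :=
  [set J | I `<=` point J].

Lemma up_set_above (X : set (set Q)) :
  X !=set0 -> up_set X = above (\bigcap_(I in X) I).
Proof. by move=> X0; apply/seteqP; split => [J []|J]. Qed.

Lemma open_setC_above I : is_ideal I -> open (~` above I).
Proof.
move=> idI; have -> : above I = up_set [set I].
  by rewrite up_set_above ?bigcap_set1 //; exists I.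
exists [set ~` up_set [set I]]; last by rewrite bigcup_set1.
move=> _ ->; apply: (finI_from1 (fun X => ~` up_set X)).
by move=> _ ->.
Qed.

(** Neighbourhoods of [J] contain finite intersections of subbasic open sets around [J], and a
    filter is closed under these, so convergence can be tested on one ideal at a time. *)
Lemma cvg_quantale_space (F : set_system (quantale_space Sigma))
    (J : quantale_space Sigma) : Filter F ->
  (forall I, is_ideal I -> ~ above I J -> F (~` above I)) -> F --> J.
Proof.
move=> FF FJ; move=> B; rewrite nbhsE => -[U [[S sS <-] [V SV VJ]] UB].
apply: filterS UB _; apply: (@filterS _ F _ V) => [x Vx|]; first by exists V.
have [D sD eV] := sS _ SV; rewrite -eV in VJ *.
apply: filter_bigI => X DX.
(* For empty [X] the set [up_set X] is empty, so its complement is the whole space. *)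
have [X0|nX0] := pselect (X !=set0); last first.
  by apply: filterS filterT => K _ [].
have Xid : X `<=` is_ideal by have := sD _ DX; rewrite inE.
have: (~` up_set X) J := VJ _ DX.
rewrite -[isSubBaseTopological.b _]/(~` up_set X) up_set_above//.
by apply: FJ; exact: bigcap_ideal.
Qed.

Lemma noetherian_compact :
  noetherian_quantale Q -> Sigma `<=` is_ideal ->
  compact [set: quantale_space Sigma].
Proof.
move=> noeth Sid; rewrite compact_ultra => F FU _.
have FF : ProperFilter F := ultra_proper.
have idP (J : quantale_space Sigma) : is_ideal (point J).
  by apply: Sid; exact: set_mem (valP (J : set_type Sigma)).
pose A : set (set Q) := [set I | is_ideal I /\ F (above I)].
have [| | |K [idK FK] Kmax] := noetherian_largest (A := A) noeth.
- by move=> I [].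
(* The least ideal lies in every point, so its [above] is the whole space. *)
- exists (\bigcap_(I in is_ideal) I); split; first exact: bigcap_ideal.
  by apply: filterS filterT => J _; apply: bigcap_inf; exact: idP.
- move=> I I' [idI FI] [idI' FI']; split; first exact: ideal_join_ideal.
  apply: filterS2 FI FI' => J IJ I'J; exact: (ideal_join_sub (point J)).
have [J KJ] := filter_ex FK; exists J; split => //.
apply: cvg_quantale_space => I idI nIJ.
(* If [above I] were in [F], then [I] would lie in [K], hence in [J]. *)
have [FI|//] := in_ultra_setVsetC (above I) FU.
by case: nIJ; apply: subset_trans KJ; exact: Kmax.
Qed.

End QuantaleSpace.

Lemma chain_compact_stationary (d : Order.disp_t) (Q : quantaleType d)
    (I : nat -> set Q) :
  (forall n, is_ideal (I n)) -> {homo I : m n / (m <= n)%N >-> m `<=` n} ->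
  cover_compact [set: quantale_space (range I)] ->
  exists N, forall n, (N <= n)%N -> I n = I N.
Proof.
move=> idI Imono cS; apply: contrapT => nst.
pose f n : set (quantale_space (range I)) := ~` above _ (I n).
have [| |D' _ D'cov] := cS nat setT f.
- by move=> n _; exact: open_setC_above.
- move=> [J JI] _; have [N _ JE] := set_mem JI.
  (* The point [J] is [I N]; if no [f n] contains it, every [I n] is included in [I N]. *)
  apply: contrapT => ncov; apply: nst; exists N => n Nn; apply/seteqP; split.
    apply: contrapT => nIn; apply: ncov; exists n => // /=.
    by rewrite /f /above /= -JE.
  exact: Imono.
have [N leN] : exists N, forall n, n \in D' -> (n <= N)%N.
  exists (\max_(n <- D') n)%N => n nD'.
  exact: (@leq_bigmax_seq _ (finmap.enum_fset D') xpredT id).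
(* As a point, [I N] contains every [I n] with [n] in [D'], so the finite subfamily misses it. *)
have IN : I N \in range I by apply/mem_set; exists N.
have [n D'n] := D'cov (SigSub IN) Logic.I.
by apply; apply: Imono; exact: leN.
Qed.

Theorem theorem4p7 (d : Order.disp_t) (Q : quantaleType d) :
  noetherian_quantale Q <->
  (forall Sigma : set (set Q), Sigma `<=` proper_ideal ->
     cover_compact [set: quantale_space Sigma]).
Proof.
split=> [noeth Sigma Sprop|cS I idI IS].
  apply: compact_setT_cover_compact; apply: noetherian_compact => // I.
  by move=> /Sprop[].
have Imono : {homo I : m n / (m <= n)%N >-> m `<=` n}.
  by apply: homo_leq => [J x|J K L KJ JL|] //; exact: subset_trans JL.
(* A chain that reaches [Q] is stationary from there on; otherwise its range consists of proper
   ideals and is an admissible [Sigma]. *)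
have [[N INT]|nIT] := pselect (exists N, I N = setT).
  by exists N => n /Imono; rewrite INT subTset.
apply: chain_compact_stationary => //; apply: cS => _ [n _ <-].
by split => // IT; apply: nIT; exists n.
Qed.
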